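(* For all positive integers $n$ and $k$ such that $n \geq k+1$, we have $B_k(P_n)=k+1$.
   Context: $P_n$ is the path on $n$ vertices $v_1,\dots,v_n$ (in order along the path), with the graph distance $\mathrm{dist}(v_i,v_j)=|i-j|$; the set of positive distances realized is $\{1,2,\dots,n-1\}$. For a set $D$ of positive integers, the distance graph $G(P_n,D)$ has vertex set $\{v_1,\dots,v_n\}$, with $v_i,v_j$ ($i\neq j$) adjacent iff $|i-j|\in D$; $\chi(P_n,D)$ denotes its chromatic number. The $k$-th Babai number is $B_k(P_n)=\max\{\chi(P_n,D): D\subseteq\{1,\dots,n-1\},\ |D|=k\}$ (defined for $k\le n-1$). *)

(* Defs.v *)
From mathcomp Require Import all_boot.
From mathcomp Require Import ssrint.

Set Implicit Arguments.
Unset Strict Implicit.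
Unset Printing Implicit Defensive.

Record sgraph := SGraph {
  vertex :> finType;
  edge : rel vertex;
  edge_sym : symmetric edge;
  edge_irrefl : irreflexive edge
}.

Definition colorable (G : sgraph) (m : nat) : bool :=
  [exists c : {ffun G -> 'I_m}, forall x, forall y, edge x y ==> (c x != c y)].

Lemma colorable_exists (G : sgraph) : exists m, colorable G m.
Proof.
exists #|G|; apply/existsP; exists [ffun x => enum_rank x].
apply/forallP => x; apply/forallP => y; apply/implyP => xy.
rewrite !ffunE; apply/eqP => /enum_rank_inj eq_xy.
by rewrite eq_xy edge_irrefl in xy.
Qed.

Definition chromatic_number (G : sgraph) : nat := ex_minn (colorable_exists G).

(* The vertex v_(i+1) of P_n is encoded as i : 'I_n. *)
Definition path_dist (n : nat) (i j : 'I_n) : nat := `|i - j|%N.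

Definition dist_rel (n : nat) (D : {pred nat}) : rel 'I_n :=
  fun i j => (i != j) && (path_dist i j \in D).

Lemma dist_rel_sym (n : nat) (D : {pred nat}) : symmetric (dist_rel (n := n) D).
Proof. by move=> i j; rewrite /dist_rel /path_dist eq_sym distnC. Qed.

Lemma dist_rel_irrefl (n : nat) (D : {pred nat}) :
  irreflexive (dist_rel (n := n) D).
Proof. by move=> i; rewrite /dist_rel eqxx. Qed.

Definition distance_graph (n : nat) (D : {pred nat}) : sgraph :=
  SGraph (@dist_rel_sym n D) (@dist_rel_irrefl n D).

(* The subsets of {1, ..., n - 1} are the D : {set 'I_n} not containing 0.
   The family of such D with k elements is empty only when k > n - 1. *)
Definition babai (n k : nat) : nat :=
  \max_(D : {set 'I_n} | [forall d in D, 0 < val d] && (#|D| == k))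
    chromatic_number (distance_graph n [in [seq val d | d in D]]).

(* Main.v *)
Require Import Defs.
From mathcomp Require Import all_boot.
From mathcomp Require Import ssrint zify.

(** Upper bound: colour the vertices greedily from left to right; each has at
    most one earlier neighbour per element of D, so k + 1 colours suffice.
    Lower bound: for D = {1, ..., k} the first k + 1 vertices form a clique. *)

Lemma exists_notin_seq (T : finType) (s : seq T) :
  size s < #|T| -> exists x, x \notin s.
Proof.
move=> lt_s; apply/existsP; apply: contraLR lt_s.
rewrite negb_exists -leqNgt cardT => /forallP s_all.
apply: uniq_leq_size (enum_uniq T) _ => x _.
exact: negbNE (s_all x).
Qed.

Lemma greedy_coloring (s : seq nat) (m : nat) :
  exists c : nat -> 'I_(size s).+1,
    forall i d, i < m -> d \in s -> 0 < d <= i -> c i != c (i - d).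
Proof.
elim: m => [|m [c c_ok]]; first by exists (fun=> ord0).
(* When [d > m], [m - d] truncates to 0, and [d = 0] gives [m] itself. Such entries merely forbid
   extra colours; the list still has length [size s], so one of the [(size s).+1] colours is
   free. *)
have [|a a_free] := exists_notin_seq 'I_(size s).+1 [seq c (m - d) | d <- s].
  by rewrite size_map card_ord.
exists (fun i => if i == m then a else c i) => i d lt_im s_d d_bnd.
case: (eqVneq i m) => [def_i | ne_im].
  rewrite def_i ifN; last by lia.
  by apply: contraNneq a_free => ->; apply/mapP; exists d.
by rewrite ifN; [apply: c_ok => //; lia | lia].
Qed.

Lemma chromatic_number_leq (G : sgraph) (m : nat) :
  colorable G m -> chromatic_number G <= m.
Proof. by rewrite /chromatic_number; case: ex_minnP => p _; apply. Qed.

(** A proper colouring is injective on a clique. *)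
Lemma clique_leq_chromatic_number (G : sgraph) (m : nat) (f : 'I_m -> G) :
  (forall i j, i != j -> edge (f i) (f j)) -> m <= chromatic_number G.
Proof.
move=> f_clique; rewrite /chromatic_number; case: ex_minnP => p.
case/existsP=> c /forallP c_ok _.
have cf_inj : injective (c \o f).
  move=> i j /= eq_c; apply: contraTeq isT => /f_clique f_ij.
  by have /forallP/(_ (f j))/implyP/(_ f_ij) := c_ok (f i); rewrite eq_c eqxx.
by have := leq_card _ cf_inj; rewrite !card_ord.
Qed.

Lemma distance_graph_colorable (n : nat) (s : seq nat) :
  colorable (distance_graph n [in s]) (size s).+1.
Proof.
have [c c_ok] := greedy_coloring s n.
apply/existsP; exists [ffun i : 'I_n => c i].
apply/forallP=> i; apply/forallP=> j; apply/implyP.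
rewrite /= /dist_rel /path_dist !ffunE => /andP[].
(* By symmetry [j] is the earlier vertex, so it equals [i - d] with [d = i - j] in [s], the form
   handled by the greedy colouring. *)
wlog lt_ji : i j / j < i => [sym_ij | _ s_d].
  case: (ltngtP j i) => [||/val_inj->]; last by rewrite eqxx.
    exact: sym_ij.
  by rewrite [i == j]eq_sym distnC [c i == _]eq_sym; apply: sym_ij.
rewrite distnEl in s_d; last exact: ltnW.
have -> : nat_of_ord j = i - (i - j) by lia.
by apply: c_ok => //; lia.
Qed.

Lemma distance_graph_clique (n k : nat) (D : {pred nat}) :
  k < n -> (forall d, 0 < d <= k -> d \in D) ->
  k < chromatic_number (distance_graph n D).
Proof.
move=> lt_kn D_d.
(* As [k < n] means [k.+1 <= n], [widen_ord lt_kn] embeds ['I_k.+1] as the first k + 1 vertices,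
   whose mutual distances lie in {1, ..., k}. *)
apply: (clique_leq_chromatic_number (distance_graph n D) _ (widen_ord lt_kn)).
move=> i j ne_ij; rewrite /= /dist_rel /path_dist -!val_eqE /=.
have ne_ij' : nat_of_ord i != j by [].
by rewrite ne_ij' D_d //; have := ltn_ord i; have := ltn_ord j; lia.
Qed.

Theorem theorem2p1 (n k : nat) (n_gt0 : 0 < n) (k_gt0 : 0 < k)
  (le_k1_n : k + 1 <= n) : babai n k = k + 1.
Proof.
rewrite addn1 in le_k1_n *; apply/eqP; rewrite eqn_leq; apply/andP; split.
  apply/bigmax_leqP => D /andP[_ /eqP card_D].
  have {1}<- : size [seq val d | d in D] = k by rewrite size_image.
  exact/chromatic_number_leq/distance_graph_colorable.
(* [lift ord0] sends i to i + 1, so this is {1, ..., k} inside ['I_n]. *)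
pose D := [set widen_ord le_k1_n (lift ord0 i) | i : 'I_k].
have D_ok : [forall d in D, 0 < val d] && (#|D| == k).
  apply/andP; split; first by apply/forall_inP => _ /imsetP[i _ ->].
  rewrite card_imset ?card_ord // => i j /(congr1 val) /= [eq_ij].
  by apply/val_inj; rewrite /= in eq_ij *; lia.
apply: (bigmax_sup D) => //.
apply: distance_graph_clique => // d /andP[d_gt0 le_dk].
have lt_d : d.-1 < k by lia.
apply/mapP; exists (widen_ord le_k1_n (lift ord0 (Ordinal lt_d))).
  by rewrite mem_enum; apply/imsetP; exists (Ordinal lt_d).
by rewrite /= /bump; lia.
Qed.
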